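(* Let $\{F_m\}_{m\in\mathbb{R}}$ be a feasible family of functions $F_m:\mathbb{R}\to[0,1]$ and suppose in addition that, for every $m$, $F_m(x)$ is increasing in $x$ and $\lim_{x\to+\infty}F_m(x)=1$. Then the associated map $$\Phi(P):=-\sup\{m\in\mathbb{R}\mid F_P\le F_m\text{ pointwise}\},\qquad P\in\mathcal{P}(\mathbb{R}),$$ is well defined as a map $\Phi:\mathcal{P}(\mathbb{R})\to\mathbb{R}\cup\{+\infty\}$, is monotone decreasing ($P\preccurlyeq Q$ implies $\Phi(P)\ge\Phi(Q)$), quasi-convex ($\Phi(\lambda P+(1-\lambda)Q)\le\Phi(P)\vee\Phi(Q)$ for $\lambda\in[0,1]$) and $\sigma(\mathcal{P},C_b)$-lower semicontinuous, and the representation $$\Phi(P)=\sup_{f\in C_b^-}R\left(\int f\,dP,f\right)=\sup_{f\in C_b^-}R^-\left(\int f\,dP,f\right),\qquad P\in\mathcal{P}(\mathbb{R}),$$ holds with $R(t,f):=\inf_{Q\in\mathcal{P}}\{\Phi(Q)\mid\int f\,dQ\ge t\}$ and $$R^-(t,f)=\sup_{s<t}R(s,f)=\inf\{m\in\mathbb{R}\mid\gamma(m,f)\ge t\},$$ where $\gamma(m,f):=\sup_{Q\in\mathcal{P}}\{\int f\,dQ\mid\Phi(Q)\le m\}$ is given, for all $m\in\mathbb{R}$ and $f\in C_b^-$, by $$\gamma(m,f)=\int f\,dF_{-m}+F_{-m}(-\infty)f(-\infty).$$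
   Context: $\mathcal{P}=\mathcal{P}(\mathbb{R})$ is the set of Borel probability measures on $\mathbb{R}$, $F_P(x)=P(-\infty,x]$, and $Q\preccurlyeq P$ iff $F_P(x)\le F_Q(x)$ for all $x\in\mathbb{R}$. $C_b$ is the space of bounded continuous functions $f:\mathbb{R}\to\mathbb{R}$ and $C_b^-=\{f\in C_b\mid f\text{ is decreasing}\}$; $\sigma(\mathcal{P},C_b)$ is the topology of weak convergence. ''Increasing'' and ''decreasing'' are meant in the weak sense. A family $\{F_m\}_{m\in\mathbb{R}}$ of functions $F_m:\mathbb{R}\to[0,1]$ is feasible if: (a) for any $P\in\mathcal{P}$ there exists $m$ such that $P\notin\mathcal{A}^m:=\{Q\in\mathcal{P}\mid F_Q\le F_m\text{ pointwise}\}$; (b) for every $m$, $x\mapsto F_m(x)$ is right continuous; (c) for every $x$, $m\mapsto F_m(x)$ is decreasing and left continuous. For a monotone function $g$, $g(-\infty):=\lim_{x\to-\infty}g(x)$; $\int f\,dF_{-m}$ is the Lebesgue–Stieltjes integral over $\mathbb{R}$ with respect to the increasing right continuous function $F_{-m}$. Conventions: $\inf\emptyset=+\infty$, $\sup\emptyset=-\infty$. *)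

(* Defs.v *)
From HB Require Import structures.
From mathcomp Require Import all_boot all_order all_algebra.
From mathcomp Require Import all_classical all_reals all_analysis.

Set Implicit Arguments.
Unset Strict Implicit.
Unset Printing Implicit Defensive.

Import Order.TTheory GRing.Theory Num.Theory.
Import numFieldTopology.Exports numFieldNormedType.Exports.

Local Open Scope classical_set_scope.
Local Open Scope ring_scope.

Notation borel_prob R := (probability (measurableTypeR R) R).

Section convex_combination.
Context d (T : measurableType d) (R : realType).
Variables (l : {i01 R}) (P Q : probability T R).

(* l P + (1 - l) Q *)
Definition pconv : set T -> \bar R :=
  measure_add (mscale l%:num%:nng P) (mscale (1 - l%:num)%:nng Q).

HB.instance Definition _ := Measure.on pconv.

Let pconv_setT : pconv [set: T] = 1%E.
Proof.
rewrite /pconv measure_addE/= /mscale/= !probability_setT.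
by rewrite !mule1 -EFinD addrC subrK.
Qed.

HB.instance Definition _ := @Measure_isProbability.Build _ _ _ pconv pconv_setT.

End convex_combination.

Section distribution_functions.
Context {R : realType}.

Definition dfun (P : borel_prob R) (x : R) : R := fine (P (`]-oo, x]%classic : set R)).

Definition sd_le (Q P : borel_prob R) : Prop :=
  forall x, dfun P x <= dfun Q x.

End distribution_functions.

Section test_functions.
Context {R : realType}.

Definition Cb : set (R -> R) := [set f | continuous f /\ bounded_fun f].

Definition Cb_dec : set (R -> R) := [set f | Cb f /\ nonincreasing_fun f].

End test_functions.

(* The coarsest topology making all maps P |-> \int f dP, f in Cb, continuous. *)
Definition weak_prob (R : realType) : topologicalType :=
  sup_topology (fun f : {f : R -> R | Cb f} =>
    Topological.class (initial_topology
      (fun P : borel_prob R => (\int[P]_x (sval f) x : R)))).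

Section feasible_families.
Context {R : realType}.
Implicit Type F : R -> R -> R.

Definition acceptance F (m : R) : set (borel_prob R) :=
  [set Q | forall x, dfun Q x <= F m x].

Record feasible F : Prop := Feasible {
  feasible_range : forall m x, 0 <= F m x <= 1 ;
  feasible_reject : forall P : borel_prob R, exists m, ~ acceptance F m P ;
  feasible_right_continuous : forall m, right_continuous (F m) ;
  feasible_decreasing : forall x, nonincreasing_fun (F^~ x) ;
  feasible_left_continuous : forall x m, F k x @[k --> m^'-] --> F m x }.

Definition assoc_map F (P : borel_prob R) : \bar R :=
  (- ereal_sup [set m%:E | m in [set m | acceptance F m P]])%E.

End feasible_families.

Section dual_functions.
Context {R : realType}.
Variable Phi : borel_prob R -> \bar R.

Definition Rfun (t : R) (f : R -> R) : \bar R :=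
  ereal_inf [set Phi Q | Q in [set Q : borel_prob R | t <= \int[Q]_x f x]].

Definition Rminus (t : R) (f : R -> R) : \bar R :=
  ereal_sup [set Rfun s f | s in [set s | s < t]].

Definition gamma (m : R) (f : R -> R) : \bar R :=
  ereal_sup [set (\int[Q]_x f x)%:E | Q in
    [set Q : borel_prob R | (Phi Q <= m%:E)%E]].

End dual_functions.

Section stieltjes.
Context {R : realType}.
Variables (G : R -> R) (Gnd : nondecreasing_fun G) (Grc : right_continuous G).

(* The proofs are arguments, so that G can be declared as cumulative. *)
Definition cumul_fun (_ : nondecreasing_fun G) (_ : right_continuous G) := G.

HB.instance Definition _ :=
  isCumulative.Build R _ R (cumul_fun Gnd Grc) Gnd Grc.

Definition stieltjes_integral (f : R -> R) : \bar R :=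
  (\int[lebesgue_stieltjes_measure (cumul_fun Gnd Grc)]_x (f x)%:E)%E.

End stieltjes.

(* Main.v *)
Require Import Defs.
From HB Require Import structures.
From mathcomp Require Import all_boot all_order all_algebra.
From mathcomp Require Import all_classical all_reals all_analysis.
From mathcomp Require Import measurable_realfun lra.

Set Implicit Arguments.
Unset Strict Implicit.
Unset Printing Implicit Defensive.

Import Order.TTheory GRing.Theory Num.Theory.
Import numFieldTopology.Exports numFieldNormedType.Exports.

Local Open Scope classical_set_scope.
Local Open Scope ring_scope.

(* By left continuity in m, Phi P <= m amounts to F_P <= F_(-m) pointwise. If
   this fails at x, right continuity of F_(-m) gives y > x with
   F_(-m)(y) < F_P(x), and a decreasing ramp f from 1 at x to 0 at y separates P
   from every Q with Phi Q <= m, because F_P(x) <= int f dP and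
   int f dQ <= F_Q(y). Lower semicontinuity and both representations follow.

   For gamma, let G = F_(-m), let mu be its Stieltjes measure and g = G(-oo),
   so that mu has total mass 1 - g. For each a, push mu forward by
   x |-> max(x, a) and put the missing mass g at a. This is a probability
   measure Q_a whose distribution function is G on [a, +oo) and 0 to the left
   of a: it is admissible, and to the right of a it is extremal for first-order
   stochastic dominance. Replacing f by f(max(x, a)) costs at most
   f(-oo) - f(a), so letting a tend to -oo yields both inequalities. *)

(** * Integration of test functions, ramps, and the weak topology *)

Section test_functions.
Context {R : realType}.
Implicit Types (P Q : borel_prob R) (f : R -> R).

Lemma Cb_measurable f : Cb f -> measurable_fun [set: measurableTypeR R] f.
Proof. by move=> [cf _]; exact: continuous_measurable_fun. Qed.

Lemma Cb_integrable (mu : {measure set (measurableTypeR R) -> \bar R}) f :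
  (mu setT < +oo)%E -> Cb f -> mu.-integrable setT (EFin \o f).
Proof.
move=> muT Cf; apply: measurable_bounded_integrable => //.
- exact: Cb_measurable.
- have [_ [M [Mr fM]]] := Cf; exists M; split => // x Mx y _; exact: fM.
Qed.

Lemma Cb_integrable_prob P f : Cb f -> P.-integrable setT (EFin \o f).
Proof.
apply: Cb_integrable; rewrite [X in (X < _)%E](_ : _ = 1%E) ?ltry//.
exact: probability_setT.
Qed.

Lemma dfunE P x : (dfun P x)%:E = P (`]-oo, x]%classic : set R).
Proof. by rewrite /dfun fineK// fin_num_measure. Qed.

Definition ramp (a b x : R) : R := Num.min 1 (Num.max 0 ((b - x) / (b - a))).

Lemma Cb_dec_ramp a b : a < b -> Cb_dec (ramp a b).
Proof.
move=> ab; split; first split.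
- move=> x.
  have cl : {for x, continuous (fun y : R => (b - y) / (b - a))}.
    apply: cvgM; last exact: cvg_cst.
    by apply: cvgB => //; exact: cvg_cst.
  apply: (@continuous_min _ _ (fun=> 1) (fun y => Num.max 0 ((b - y) / (b - a)))).
    exact: cvg_cst.
  apply: (@continuous_max _ _ (fun=> 0) (fun y => (b - y) / (b - a))) => //.
  exact: cvg_cst.
- exists 1; split => // M M1 x _ /=; apply/ltW/(le_lt_trans _ M1).
  rewrite ger0_norm /ramp ?ge_min ?lexx//.
  by rewrite le_min ler01 le_max lexx.
- move=> x y xy; rewrite /ramp le_min !ge_min lexx /= ge_max !le_max lexx /=.
  by rewrite ler_pM2r ?lerB ?orbT ?invr_gt0 ?subr_gt0.
Qed.

(** The ramp equals 1 on []-oo, a]], so it dominates the indicator of that half-line. *)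
Lemma dfun_le_ramp P a b : a < b -> dfun P a <= \int[P]_x ramp a b x.
Proof.
move=> ab; have [Cr _] := Cb_dec_ramp ab.
rewrite -lee_fin dfunE /Rintegral fineK; last first.
  exact: integrable_fin_num (Cb_integrable_prob P Cr).
rewrite -[X in P X]setIT -integral_indic//=.
apply: ge0_le_integral => //=.
- by apply/measurable_EFinP; exact: measurable_indic.
- exact: measurable_int (Cb_integrable_prob P Cr).
- move=> x _; rewrite lee_fin indicE /ramp.
  case: (boolP (x \in _)) => /=; last first.
    by rewrite le_min ler01 le_max lexx.
  rewrite inE /= in_itv /= => xa.
  by rewrite le_min lexx /= le_max ler_pdivlMr ?subr_gt0// mul1r lerB ?orbT.
Qed.

(** The ramp is at most 1 and vanishes from [b] on, so the indicator of []-oo, b]] dominates it. *)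
Lemma ramp_le_dfun P a b : a < b -> \int[P]_x ramp a b x <= dfun P b.
Proof.
move=> ab; have [Cr _] := Cb_dec_ramp ab.
rewrite -lee_fin dfunE /Rintegral fineK; last first.
  exact: integrable_fin_num (Cb_integrable_prob P Cr).
rewrite -[X in (_ <= P X)%E]setIT -integral_indic//=.
apply: ge0_le_integral => //=.
- by move=> x _; rewrite lee_fin /ramp le_min ler01 le_max lexx.
- exact: measurable_int (Cb_integrable_prob P Cr).
- by apply/measurable_EFinP; exact: measurable_indic.
- move=> x _; rewrite lee_fin indicE /ramp; case: (boolP (x \in _)) => /=.
    by rewrite ge_min lexx.
  rewrite notin_setE /= in_itv /= => /negP; rewrite -ltNge => bx.
  rewrite ge_min ge_max lexx /= ler_pdivrMr ?subr_gt0// mul0r subr_le0 (ltW bx) orbT//.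
Qed.

(** Convergence in a supremum of topologies entails convergence in each of them, in particular in
    the initial topology of integration against [f]. *)
Lemma continuous_weak_Rintegral f : Cb f ->
  continuous (fun P : weak_prob R => \int[P]_x f x : R).
Proof.
move=> Cf P.
have : nbhs (P : weak_prob R) --> (P : weak_prob R) by [].
move/(cvg_sup (fun f : {f : R -> R | Cb f} =>
    Topological.class (initial_topology
      (fun P : borel_prob R => (\int[P]_x (sval f) x : R)))) _ _).1.
move=> /(_ (exist _ f Cf)) h.
apply: (cvg_trans _ (@initial_continuous _ _
  (fun P : borel_prob R => (\int[P]_x f x : R)) P)).
exact: (cvg_app _ h).
Qed.

End test_functions.

(** * Comparing extended reals through real levels *)

Lemma lee_EFin_ub {R : realType} (x y : \bar R) :
  (-oo < y)%E -> (forall m : R, (y <= m%:E)%E -> (x <= m%:E)%E) -> (x <= y)%E.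
Proof. by case: y => [y||] // _ h; [exact: h|rewrite leey]. Qed.

Lemma ereal_densely_EFin {R : realType} (x y : \bar R) :
  (x < y)%E -> exists m : R, (x < m%:E < y)%E.
Proof.
move: x y => [r||] [s||] //=.
- by rewrite lte_fin => rs; exists ((r + s) / 2); rewrite !lte_fin !midf_lt.
- by exists (r + 1); rewrite lte_fin ltrDl ltr01 ltry.
- by exists (s - 1); rewrite ltNyr lte_fin gtrDl oppr_lt0 ltr01.
- by exists 0; rewrite ltNyr ltry.
Qed.

Lemma lee_EFin_lb {R : realType} (x y : \bar R) :
  (forall m : R, (m%:E < x)%E -> (m%:E <= y)%E) -> (x <= y)%E.
Proof.
move=> h; rewrite leNgt; apply/negP => /ereal_densely_EFin[m /andP[ym mx]].
by have := h _ mx; rewrite leNgt ym.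
Qed.

(** * The associated map: sublevel sets, monotonicity, quasi-convexity, semicontinuity *)

Section assoc_map.
Context {R : realType} {F : R -> R -> R} (hF : feasible F).
Implicit Types (P Q : borel_prob R).
Let Phi := assoc_map F.

(** The supremum defining [Phi P] need not be attained a priori. Each [k < - m] lies below some
    accepted [m'], whence F_P <= F_(m') <= F_k; left continuity in the index then lets [k] increase
    to [- m]. *)
Lemma assoc_map_leP P (m : R) : (Phi P <= m%:E)%E <-> acceptance F (- m) P.
Proof.
split=> [|acc]; last first.
  by rewrite /Phi /assoc_map leeNl; apply: ereal_sup_ubound; exists (- m).
rewrite /Phi /assoc_map leeNl => mP x.
apply: (cvgr_to_ge (feasible_left_continuous hF (x := x) (m := -m))).
near=> k.
have : (k%:E < ereal_sup [set m%:E | m in [set m | acceptance F m P]])%E.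
  by apply: lt_le_trans mP; rewrite lte_fin; near: k; exact: nbhs_left_lt.
move=> /ereal_sup_gt[_ [m' acc <-]]; rewrite lte_fin => /ltW km'.
by apply: (le_trans (acc x)); exact: (feasible_decreasing hF).
Unshelve. all: by end_near. Qed.

Lemma assoc_map_gtP P (m : R) : (m%:E < Phi P)%E <-> exists x, F (- m) x < dfun P x.
Proof.
rewrite ltNge; split => [/negP h|[x Fx]].
  by apply/not_existsP => h'; apply/h/assoc_map_leP => x; rewrite leNgt; apply/negP/h'.
by apply/negP => /assoc_map_leP /(_ x); rewrite leNgt Fx.
Qed.

Lemma assoc_map_gtNy P : (-oo < Phi P)%E.
Proof.
have [m rej] := feasible_reject hF P.
apply: (lt_trans (ltNyr (- m))); rewrite ltNge; apply/negP => /assoc_map_leP.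
by rewrite opprK.
Qed.

Lemma assoc_map_anti P Q : sd_le P Q -> (Phi Q <= Phi P)%E.
Proof.
move=> PQ; apply: lee_EFin_ub => [|m /assoc_map_leP h]; first exact: assoc_map_gtNy.
by apply/assoc_map_leP => x; exact: le_trans (PQ x) (h x).
Qed.

Lemma dfun_pconv (l : {i01 R}) P Q x :
  dfun (pconv l P Q) x = l%:num * dfun P x + (1 - l%:num) * dfun Q x.
Proof.
apply/EFin_inj; rewrite dfunE EFinD !EFinM !dfunE.
exact: measure_addE.
Qed.

(** Distribution functions are affine in the measure, so acceptance sets are convex, and these are
    the sublevel sets of [Phi]. *)
Lemma assoc_map_quasiconvex (l : {i01 R}) P Q :
  (Phi (pconv l P Q) <= maxe (Phi P) (Phi Q))%E.
Proof.
apply: lee_EFin_ub => [|m]; first by rewrite lt_max assoc_map_gtNy.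
rewrite ge_max => /andP[/assoc_map_leP hP /assoc_map_leP hQ]; apply/assoc_map_leP => x.
rewrite dfun_pconv; have := hP x; have := hQ x.
set p := dfun P x; set q := dfun Q x => qF pF.
have l0 : 0 <= l%:num by [].
have l1 : l%:num <= 1 by [].
have := ler_wpM2l l0 pF; have : (1 - l%:num) * q <= (1 - l%:num) * F (- m) x.
  by apply: ler_wpM2l; rewrite ?subr_ge0.
move=> /[swap] h1 h2; apply: le_trans (lerD h1 h2) _.
by rewrite -mulrDl addrCA subrr addr0 mul1r.
Qed.

Lemma separating_test_function P (m : R) : (m%:E < Phi P)%E ->
  exists f c, [/\ Cb_dec f, c < \int[P]_x f x &
    forall Q, c < \int[Q]_x f x -> (m%:E < Phi Q)%E].
Proof.
move=> /assoc_map_gtP[x Fx].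
have [y xy Fy] : exists2 y, x < y & F (- m) y < dfun P x.
  have Fy : \forall y \near x^'+, F (- m) y < dfun P x.
    exact: (cvgr_lt _ (feasible_right_continuous hF (m := - m) (x := x)) _ Fx).
  by near (x^'+) => y; exists y; near: y => //; exact: nbhs_right_gt.
(* The threshold [F (- m) y] lies below F_P(x), hence below the integral of the ramp under [P]; a
   measure [Q] whose integral exceeds it has F_Q(y) > F_(-m)(y), so it is not accepted at level
   [- m]. *)
exists (ramp x y), (F (- m) y); split => [||Q cQ]; first exact: Cb_dec_ramp.
  by apply: lt_le_trans Fy _; exact: dfun_le_ramp.
by apply/assoc_map_gtP; exists y; apply: lt_le_trans cQ _; exact: ramp_le_dfun.
Unshelve. all: by end_near. Qed.

Lemma assoc_map_lsc : lower_semicontinuous (Phi : weak_prob R -> \bar R).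
Proof.
move=> P m /separating_test_function[f [c [[Cf _] cP h]]].
(* This half-space is a weak neighbourhood of [P] because [f] is a continuous bounded test
   function. *)
exists [set Q : weak_prob R | c < \int[Q]_x f x]; last by move=> Q; exact: h.
have /cvgr_gt := @continuous_weak_Rintegral _ _ Cf P; exact.
Qed.

End assoc_map.

(** * The functions R, R^- and gamma for an arbitrary map *)

Section dual_functions.
Context {R : realType} (Psi : borel_prob R -> \bar R).
Implicit Types (P : borel_prob R) (f : R -> R) (s t : R).

Lemma Rfun_nondecreasing f s t : s <= t ->
  (Rfun Psi s f <= Rfun Psi t f)%E.
Proof.
move=> st; apply: le_ereal_inf_tmp => _ [Q /= tQ <-].
by apply: ereal_inf_lbound; exists Q => //=; exact: le_trans tQ.
Qed.

Lemma Rfun_le f P : (Rfun Psi (\int[P]_x f x) f <= Psi P)%E.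
Proof. by apply: ereal_inf_lbound; exists P => /=. Qed.

Lemma Rminus_le_Rfun f t : (Rminus Psi t f <= Rfun Psi t f)%E.
Proof. by apply: ge_ereal_sup => _ [s /= /ltW st <-]; exact: Rfun_nondecreasing. Qed.

(** R and gamma are generalized inverses of each other. If s < t <= gamma(m, f), some [Q] at level
    [m] integrates [f] above [s], so R(s, f) <= m. Conversely, if R^-(t, f) < m, then every s < t is
    reached by such a [Q], so gamma(m, f) >= t. *)
Lemma Rminus_gamma t f :
  Rminus Psi t f =
    ereal_inf [set m%:E | m in [set m : R | (t%:E <= gamma Psi m f)%E]].
Proof.
apply/le_anti/andP; split.
  apply: ge_ereal_sup => _ [s /= st <-]; apply: le_ereal_inf_tmp => _ [m /= tm <-].
  have /ereal_sup_gt[_ [Q /= Qm <-]] : (s%:E < gamma Psi m f)%E by apply: lt_le_trans tm.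
  rewrite lte_fin => /ltW sQ; apply: le_trans Qm; apply: ereal_inf_lbound; by exists Q.
rewrite leNgt; apply/negP => /ereal_densely_EFin[m /andP[Rm mi]].
move: mi; rewrite ltNge => /negP; apply; apply: ereal_inf_lbound; exists m => //=.
apply: lee_EFin_lb => s; rewrite lte_fin => st.
have /ereal_inf_lt[_ [Q /= sQ <-] Qm] : (Rfun Psi s f < m%:E)%E.
  by apply: le_lt_trans Rm; apply: ereal_sup_ubound; exists s.
apply: (@le_trans _ _ (\int[Q]_x f x)%:E); first by rewrite lee_fin.
by apply: ereal_sup_ubound; exists Q => //=; exact: ltW.
Qed.

End dual_functions.

(** * The two dual representations *)

Section duality.
Context {R : realType} {F : R -> R -> R} (hF : feasible F).
Implicit Types (P Q : borel_prob R).
Let Phi := assoc_map F.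

Lemma le_Rminus_sup P :
  (Phi P <= ereal_sup [set Rminus Phi (\int[P]_x f x) f | f in Cb_dec])%E.
Proof.
apply: lee_EFin_lb => m /(separating_test_function hF)[f [c [Cf cP h]]].
apply: (@le_trans _ _ (Rminus Phi (\int[P]_x f x) f)); last first.
  by apply: ereal_sup_ubound; exists f.
(* The midpoint is strictly below the integral under [P], as R^- requires, and strictly above [c],
   so that every competitor [Q] falls under the separation property. *)
pose s := (c + \int[P]_x f x) / 2.
apply: (@le_trans _ _ (Rfun Phi s f)); last first.
  by apply: ereal_sup_ubound; exists s => //=; rewrite midf_lt.
apply: le_ereal_inf_tmp => _ [Q /= sQ <-]; apply/ltW/h/(lt_le_trans _ sQ).
by rewrite midf_lt.
Qed.

Lemma assoc_map_Rminus P :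
  Phi P = ereal_sup [set Rminus Phi (\int[P]_x f x) f | f in Cb_dec].
Proof.
apply/le_anti/andP; split; first exact: le_Rminus_sup.
apply: ge_ereal_sup => _ [f _ <-].
exact: le_trans (Rminus_le_Rfun _ _ _) (Rfun_le _ _ _).
Qed.

(** Both representations come from the chain Phi <= sup R^- <= sup R <= Phi. *)
Lemma assoc_map_Rfun P :
  Phi P = ereal_sup [set Rfun Phi (\int[P]_x f x) f | f in Cb_dec].
Proof.
apply/le_anti/andP; split; last by apply: ge_ereal_sup => _ [f _ <-]; exact: Rfun_le.
apply: (le_trans (le_Rminus_sup P)); apply: ge_ereal_sup => _ [f Cf <-].
by apply: (le_trans (Rminus_le_Rfun _ _ _)); apply: ereal_sup_ubound; exists f.
Qed.

End duality.

(** * Stochastic dominance to the right of a point *)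

Section clamp.
Context {R : realType}.
Implicit Types (P Q : borel_prob R) (f : R -> R) (U : set R).

(** Apart from the empty set and the whole line, [U] is the open half-line to the right of its
    infimum. That infimum is at least [a], since [U] contains no point up to [a], so the
    distribution functions are compared only where they are ordered. *)
Lemma upper_set_mass P Q (a : R) U : open U ->
    (forall x y, U x -> x <= y -> U y) -> (forall x, x <= a -> U x -> U = setT) ->
    (forall x, a <= x -> dfun P x <= dfun Q x) ->
  (Q U <= P U)%E.
Proof.
move=> oU upU aU PQ.
have [->|/set0P[u Uu]] := eqVneq U set0; first by rewrite !measure0.
have [->|UT] := pselect (U = setT).
  rewrite [leLHS](_ : _ = 1%E) 1?[leRHS](_ : _ = 1%E)//; exact: probability_setT.
have aux x : U x -> a < x.
  by move=> Ux; rewrite ltNge; apply/negP => xa; exact/UT/(aU x).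
have infU : has_inf U by split; [exists u|exists a => x /aux/ltW].
have UE : U = ~` `]-oo, inf U].
  apply/seteqP; split => x /=; rewrite in_itv/=; last first.
    move=> /negP; rewrite -ltNge => /(inf_lt infU.1)[y Uy /ltW]; exact: upU.
  move=> Ux; apply/negP; rewrite -ltNge lt_neqAle (ge_inf infU.2 Ux) andbT.
  apply/eqP => xE.
  (* Were the infimum in [U], openness would also put the smaller point [x - e / 2] in [U]. *)
  have /nbhs_ballP[e /= e0 xeU] : nbhs x U by apply: open_nbhs_nbhs.
  have /(ge_inf infU.2) : U (x - e / 2).
    apply: xeU; rewrite /ball /= opprB addrC subrK gtr0_norm ?divr_gt0//.
    by rewrite ltr_pdivrMr// ltr_pMr// ltr1n.
  by rewrite xE leNgt ltrBlDr ltrDl divr_gt0.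
have : a <= inf U by apply: lb_le_inf; [exists u|move=> x /aux/ltW].
move: (inf U) UE => b -> ab.
rewrite !probability_setC -?dfunE//.
by rewrite -!EFinB lee_fin lerD2l lerN2 PQ.
Qed.

Definition clamp (a : R) (x : measurableTypeR R) : measurableTypeR R :=
  Num.max x a.

Lemma measurable_clamp a : measurable_fun [set: measurableTypeR R] (clamp a).
Proof. exact: measurable_maxr. Qed.

Lemma clamp_id a x : clamp a (clamp a x) = clamp a x.
Proof. by rewrite /clamp -maxA maxxx. Qed.

Lemma continuous_clamp a : continuous (clamp a : R -> R).
Proof.
move=> x; apply: (@continuous_max _ _ id (fun=> a)) => //; exact: cvg_cst.
Qed.

Lemma bounded_fun_norm (f : R -> R) : bounded_fun f -> exists M, forall x, `|f x| <= M.
Proof.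
move=> [M [Mr fM]]; exists (M + 1) => x; apply: (fM (M + 1)) => //.
by rewrite ltrDl.
Qed.

Lemma Cb_clamp a f : Cb f -> Cb (f \o clamp a).
Proof.
move=> [cf [M [Mr fM]]]; split.
  by move=> x; apply: continuous_comp; [exact: continuous_clamp|exact: cf].
by exists M; split => // x Mx y _; exact: fM.
Qed.

(* The layer-cake formula for M - f(max(x, a)) reduces the claim to the masses of
   its superlevel sets, which are open upper sets. *)
Lemma Rintegral_clamp_le P Q a f : Cb_dec f ->
    (forall x, a <= x -> dfun P x <= dfun Q x) ->
  \int[P]_x f (clamp a x) <= \int[Q]_x f (clamp a x).
Proof.
move=> [Cf df] PQ.
have Cfa := Cb_clamp a Cf.
have [M fM] : exists M, forall x, f x <= M.
  have [M fM] := bounded_fun_norm Cf.2.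
  by exists M => x; exact: le_trans (ler_norm _) (fM x).
pose X (x : measurableTypeR R) := M - f (clamp a x).
have mX : measurable_fun setT X.
  by apply: measurable_funB => //; exact: Cb_measurable.
pose XR : {mfun measurableTypeR R >-> R} :=
  HB.pack X (isMeasurableFun.Build _ _ _ _ X mX).
have X0 x : 0 <= XR x by rewrite subr_ge0.
have E (S : borel_prob R) : (\int[S]_x (XR x)%:E)%E = (M - \int[S]_x f (clamp a x))%:E.
  have iM : S.-integrable setT (EFin \o (fun=> M)).
    exact: finite_measure_integrable_cst.
  have iX : S.-integrable setT (EFin \o XR).
    apply: (@integrableB _ _ _ S setT _
      (EFin \o fun=> M) (EFin \o (f \o clamp a))) => //.
    exact: Cb_integrable_prob.
  have -> : (\int[S]_x (XR x)%:E)%E = (\int[S]_x XR x)%:E.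
    by rewrite /Rintegral fineK//; exact: integrable_fin_num iX.
  congr EFin; rewrite [LHS]RintegralB//; last exact: Cb_integrable_prob.
  rewrite Rintegral_cst// [X in fine X](_ : _ = 1%E) ?mulr1//; exact: probability_setT.
suff : (\int[Q]_x (XR x)%:E <= \int[P]_x (XR x)%:E)%E.
  by rewrite !E lee_fin lerD2l lerN2.
rewrite -(@expectation_def _ _ _ Q XR) -(@expectation_def _ _ _ P XR).
rewrite !ge0_expectation_ccdf//.
apply: ge0_le_integral => //=.
- exact: measurable_funTS (@ccdf_measurable _ _ _ Q XR).
- exact: measurable_funTS (@ccdf_measurable _ _ _ P XR).
move=> r r0.
rewrite /ccdf /distribution /pushforward; apply: (@upper_set_mass P Q a) => //.
- have -> : X @^-1` `]r, +oo[ = (fun x : R => f (clamp a x)) @^-1` `]-oo, M - r[.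
    by apply/seteqP; split => x; rewrite /= !in_itv/= andbT /X ltrBrDr ltrBrDl addrC.
  apply: open_comp; last exact: interval_open.
  by move=> x _; exact: Cfa.1.
- move=> x y; rewrite /= !in_itv/= !andbT /X => rx xy; apply: (lt_le_trans rx).
  rewrite lerD2l lerN2; apply: df; rewrite /clamp ge_max !le_max xy lexx orbT//.
(* On []-oo, a]] the function [X] is constant and equal to its minimum, so a superlevel set meeting
   that half-line is everything. *)
- move=> x xa; rewrite /= in_itv/= andbT /X => rx; apply/seteqP; split => // y _.
  rewrite /= in_itv/= andbT /X; apply: (lt_le_trans rx).
  by rewrite lerD2l lerN2; apply: df; rewrite /clamp (max_r xa) le_max lexx orbT.
Qed.

End clamp.

(** * The clamped measure with an atom at [a] *)

Section clamped_measure.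
Context {R : realType} (mu : {measure set (measurableTypeR R) -> \bar R}).
Variables (k : {nonneg R}) (a : R).

Definition clamp_pushforward : {measure set (measurableTypeR R) -> \bar R}.
Proof. by refine (pushforward mu (clamp a)); exact: measurable_clamp. Defined.

Definition clamped : set (measurableTypeR R) -> \bar R :=
  measure_add clamp_pushforward (mscale k (dirac (a : measurableTypeR R))).

HB.instance Definition _ := Measure.on clamped.

Lemma clampedE A : clamped A =
  (mu (clamp a @^-1` A) + k%:num%:E * dirac (a : measurableTypeR R) A)%E.
Proof. exact: measure_addE. Qed.

(** Scaling is applied to the positive and negative parts separately; at most one of them is nonzero
    at [a], so their difference is defined and the factor distributes over it. *)
Lemma integral_mscale_dirac (f : measurableTypeR R -> \bar R) : measurable_fun setT f ->
  (\int[mscale k (dirac (a : measurableTypeR R))]_x f x = k%:num%:E * f a)%E.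
Proof.
move=> mf; rewrite integralE !ge0_integral_mscale//; last 2 first.
- exact: measurable_funeneg.
- exact: measurable_funepos.
rewrite !integral_dirac//; last 2 first.
- exact: measurable_funeneg.
- exact: measurable_funepos.
rewrite diracT !mul1e.
rewrite -muleBr//; last exact: add_def_funeposneg.
by rewrite [in RHS](funeposneg f).
Qed.

Hypothesis muk : (mu setT + k%:num%:E = 1)%E.

Let muT_lty : (mu setT < +oo)%E.
Proof.
rewrite ltNge leye_eq; apply/negP => /eqP muT; move: muk; by rewrite muT addye.
Qed.

Lemma integral_clamped f : Cb f ->
  (\int[clamped]_x (f x)%:E = \int[mu]_x (f (clamp a x))%:E + (k%:num * f a)%:E)%E.
Proof.
move=> Cf; have mf : measurable_fun setT (EFin \o f).
  by apply/measurable_EFinP; exact: Cb_measurable.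
have ip : clamp_pushforward.-integrable setT (EFin \o f).
  apply: Cb_integrable => //; exact: muT_lty.
rewrite integral_measure_add//=; last first.
  have kdT : mscale k (dirac (a : measurableTypeR R)) setT = k%:num%:E.
    by rewrite /mscale -[RHS]mule1; congr (_ * _)%E; exact: diracT.
  apply: (@Cb_integrable _ (mscale k (dirac (a : measurableTypeR R))) f _ Cf).
  by rewrite [X in (X < _)%E]kdT ltry.
rewrite integral_mscale_dirac//; congr (_ + _)%E.
apply: (integral_pushforward (@measurable_clamp _ a)) => //.
apply: Cb_integrable; first exact: muT_lty.
exact: Cb_clamp.
Qed.

Let clamped_setT : clamped setT = 1%E.
Proof. by rewrite clampedE preimage_setT diracT mule1. Qed.

HB.instance Definition _ := @Measure_isProbability.Build _ _ _ clamped clamped_setT.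

Definition clamped_prob : borel_prob R := clamped.

End clamped_measure.

(** * Stieltjes masses of half-lines and of the whole line *)

Section lebesgue_stieltjes_mass.
Context {R : realType} (G : R -> R).
Context (Gnd : nondecreasing_fun G) (Grc : right_continuous G).
Variable g : R.
Hypotheses (GNy : G x @[x --> -oo] --> g) (Gy : G x @[x --> +oo] --> (1 : R)).
Let mu : {measure set (measurableTypeR R) -> \bar R} :=
  lebesgue_stieltjes_measure (cumul_fun Gnd Grc).

Lemma lebesgue_stieltjes_ocitv a b : a <= b ->
  mu (`]a, b]%classic : set R) = (G b - G a)%:E.
Proof.
move=> ab; rewrite /mu /= /lebesgue_stieltjes_measure /measure_extension/=.
by rewrite measurable_mu_extE/= ?wlength_itv_bnd//; exact: is_ocitv.
Qed.

Let GNyn : G (- n%:R) @[n --> \oo] --> g.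
Proof.
apply: (cvg_ninftyP _ _).1 GNy _ _.
by apply: (cvg_comp _ _ cvgr_idn); rewrite ninfty.
Qed.

(** Continuity from below along the intervals []-n, x]], whose masses G(x) - G(-n) tend to G(x) -
    g. *)
Lemma lebesgue_stieltjes_Nycitv x : mu (`]-oo, x]%classic : set R) = (G x - g)%:E.
Proof.
rewrite itvNybndEbigcup.
have : mu (`](-n%:R)%R, x]%classic : set R) @[n --> \oo] --> (G x - g)%:E.
  suff : ((G x)%:E - (G (-n%:R))%:E)%E @[n --> \oo] --> (G x - g)%:E.
    (* The mass formula for []-n, x]] requires [-n <= x], hence holds only for large [n]. *)
    apply: cvg_trans; apply: near_eq_cvg; near=> n.
    rewrite lebesgue_stieltjes_ocitv//.
    by rewrite lerNl; near: n; exact: nbhs_infty_ger.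
  by apply/cvg_EFin; [near=> n|apply: cvgB => //; exact: cvg_cst].
have : mu (`](-n%:R)%R, x]%classic : set R) @[n --> \oo] -->
    mu (\bigcup_n `]- n%:R, x]%classic).
  apply: nondecreasing_cvg_mu => //; first exact: bigcup_measurable.
  by move=> *; apply/subsetPset/subset_itv; rewrite leBSide//= lerN2 ler_nat.
exact: cvg_unique.
Unshelve. all: by end_near. Qed.

Lemma lebesgue_stieltjes_setT : mu setT = (1 - g)%:E.
Proof.
pose I n : set R := `]-oo, n%:R]%classic.
have <- : \bigcup_n I n = setT.
  rewrite -subTset => t _; exists (Num.bound `|t|) => //.
  by rewrite /I/= in_itv/=; apply/ltW/(le_lt_trans (ler_norm t))/archi_boundP.
have : (mu \o I) n @[n --> \oo] --> (1 - g)%:E.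
  under eq_fun do rewrite /= lebesgue_stieltjes_Nycitv.
  apply/cvg_EFin; [by near=> n|apply: cvgB; last exact: cvg_cst].
  exact: (cvg_comp _ _ (@cvgr_idn R)).
have : (mu \o I) n @[n --> \oo] --> mu (\bigcup_n I n).
  apply: nondecreasing_cvg_mu; rewrite /I//; first exact: bigcup_measurable.
  by move=> m n mn; apply/subsetPset; apply: subset_itvl; rewrite bnd_simp ler_nat.
exact: cvg_unique.
Unshelve. all: by end_near. Qed.

End lebesgue_stieltjes_mass.

(** * Limits of monotone functions at -oo *)

Section monotone_limits.
Context {R : realType}.
Implicit Types f : R -> R.

(** Reflection through 0 turns this into the limit at +oo of an increasing function. Identifying the
    limit as a supremum later yields both f <= f(-oo) and approximation of f(-oo) by values of f. *)
Lemma nonincreasing_cvgNyr f : nonincreasing_fun f -> has_ubound (range f) ->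
  f x @[x --> -oo] --> sup (range f).
Proof.
move=> df ubf; apply/cvgNy_compNP.
have -> : range f = range (f \o -%R).
  by apply/seteqP; split => _ [x _ <-]; [exists (- x); rewrite //= opprK|exists (- x)].
apply: nondecreasing_cvgr => [x y xy|]; first by apply: df; rewrite lerN2.
by have [M fM] := ubf; exists M => _ [x _ <-]; apply: fM; exists (- x).
Qed.

Lemma nondecreasing_is_cvgNyr f : nondecreasing_fun f -> has_lbound (range f) ->
  cvg (f x @[x --> -oo]).
Proof.
move=> df [M fM]; have -> : f = fun x => - (- f x) by apply/funext => x; rewrite opprK.
apply: is_cvgN; apply/cvg_ex; eexists; apply: nonincreasing_cvgNyr.
  by move=> x y xy; rewrite lerN2; exact: df.
by exists (- M) => _ [x _ <-]; rewrite lerN2; apply: fM; exists x.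
Qed.

End monotone_limits.

(** * Integral bounds under the constraint F_Q <= G *)

Section stieltjes_bound.
Context {R : realType} (G : R -> R).
Context (Gnd : nondecreasing_fun G) (Grc : right_continuous G).
Hypotheses (G0 : forall x, 0 <= G x) (Gy : G x @[x --> +oo] --> (1 : R)).
Variable f : R -> R.
Hypothesis Cf : Cb_dec f.
Let g := lim (G x @[x --> -oo]).
Let L := lim (f x @[x --> -oo]).
Let mu : {measure set (measurableTypeR R) -> \bar R} :=
  lebesgue_stieltjes_measure (cumul_fun Gnd Grc).
(** The claimed value of gamma as a real number; [stieltjes_integralE] links it to the extended-real
    formula. *)
Let J := \int[mu]_x f x + g * L.

Let GNy : G x @[x --> -oo] --> g.
Proof.
by apply: nondecreasing_is_cvgNyr => //; exists 0 => _ [x _ <-]; exact: G0.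
Qed.

Let g0 : 0 <= g.
Proof. by apply: (cvgr_to_ge GNy); near=> x; exact: G0. Unshelve. all: by end_near. Qed.

Let gpos : {nonneg R} := NngNum g0.

Let muT : (mu setT + gpos%:num%:E = 1)%E.
Proof. by rewrite (lebesgue_stieltjes_setT Gnd Grc GNy Gy) /= -EFinD subrK. Qed.

Let muT_lty : (mu setT < +oo)%E.
Proof. by rewrite (lebesgue_stieltjes_setT Gnd Grc GNy Gy) ltry. Qed.

Let Q_ a : borel_prob R := clamped_prob a muT.

(** For a <= x clamping preserves []-oo, x]], of [mu]-mass G(x) - g, and the atom at [a] restores
    g. *)
Let dfunQ a x : a <= x -> dfun (Q_ a) x = G x.
Proof.
move=> ax; apply: EFin_inj; rewrite dfunE [LHS]clampedE.
rewrite diracE mem_set/= ?in_itv// mule1.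
rewrite (_ : _ @^-1` _ = `]-oo, x]%classic); last first.
  by apply/seteqP; split => y; rewrite /= !in_itv /= /clamp ge_max ax andbT.
by rewrite (lebesgue_stieltjes_Nycitv Gnd Grc GNy) -EFinD subrK.
Qed.

Let dfunQ_le a x : dfun (Q_ a) x <= G x.
Proof.
have [/dfunQ->//|xa] := leP a x.
rewrite -lee_fin dfunE [leLHS]clampedE.
rewrite diracE memNset/= ?mule0; last by rewrite in_itv/= leNgt xa.
rewrite (_ : _ @^-1` _ = set0); first by rewrite measure0 add0e lee_fin.
by apply/seteqP; split => y //=; rewrite in_itv/= /clamp ge_max [a <= x]leNgt xa andbF.
Qed.

Let int_fin : (\int[mu]_x (f x)%:E = (\int[mu]_x f x)%:E)%E.
Proof.
by rewrite /Rintegral fineK//; exact: integrable_fin_num (Cb_integrable muT_lty Cf.1).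
Qed.

Let intQ a h : Cb h -> \int[Q_ a]_x h x = \int[mu]_x h (clamp a x) + g * h a.
Proof.
move=> Ch; rewrite {1}/Rintegral [X in fine X](integral_clamped a muT Ch) fineD//.
exact: integrable_fin_num (Cb_integrable muT_lty (Cb_clamp a Ch)).
Qed.

Let has_ub : has_ubound (range f).
Proof.
have [M fM] := bounded_fun_norm Cf.1.2.
by exists M => _ [x _ <-]; exact: le_trans (ler_norm _) (fM x).
Qed.

Let LE : L = sup (range f).
Proof. by apply/cvg_lim => //; exact: nonincreasing_cvgNyr Cf.2 has_ub. Qed.

Let f_le x : f x <= L.
Proof. by rewrite LE; apply: ub_le_sup => //; exists x. Qed.

Let f_near e : 0 < e -> exists a, L - f a <= e.
Proof.
move=> e0; have sup_f : has_sup (range f) by split => //; exists (f 0), 0.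
have [_ [a _ <-]] := sup_adherent e0 sup_f.
rewrite -LE => h; exists a; rewrite lerBlDr -lerBlDl; exact: ltW.
Qed.

Let clamp_le a x : f (clamp a x) <= f x.
Proof. by apply: Cf.2; rewrite /clamp le_max lexx. Qed.

Let clamp_ge a x : f x <= f (clamp a x) + (L - f a).
Proof.
rewrite /clamp; have [xa|ax] := leP x a; first by rewrite addrC subrK.
by rewrite lerDl subr_ge0.
Qed.

Let Cfa a := Cb_clamp a Cf.1.

(** Clamping lowers [f] by at most [L - f a] at each point. An arbitrary finite measure is allowed
    because the bound serves both for [Q], of mass 1, and for [mu], of mass 1 - g. *)
Let le_Rintegral_clamp (nu : {measure set (measurableTypeR R) -> \bar R}) a :
  (nu setT < +oo)%E ->
  \int[nu]_x f x <= \int[nu]_x f (clamp a x) + (L - f a) * fine (nu setT).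
Proof.
move=> nuT; have inu := Cb_integrable nuT.
have ic : nu.-integrable setT (EFin \o (fun=> L - f a)).
  by apply: measurable_bounded_integrable => //; exact: bounded_cst.
apply: (@le_trans _ _ (\int[nu]_x (f (clamp a x) + (L - f a)))).
  apply: le_Rintegral => //; first exact: inu Cf.1.
  apply: (@integrableD _ _ _ nu setT _
    (EFin \o (f \o clamp a)) (EFin \o fun=> L - f a)) => //.
  exact: inu (Cfa a).
by rewrite RintegralD//; [rewrite Rintegral_cst|exact: inu (Cfa a)].
Qed.

Lemma Rintegral_le_stieltjes (Q : borel_prob R) : (forall x, dfun Q x <= G x) ->
  \int[Q]_x f x <= J.
Proof.
move=> QG; apply/ler_addgt0Pr => e /f_near[a La].
have QT : Q setT = 1%E by exact: probability_setT.
apply: (le_trans (@le_Rintegral_clamp Q a _)); first by rewrite [X in (X < _)%E]QT ltry.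
rewrite [X in fine X]QT mulr1; apply: lerD => //.
(* From [a] on, [Q_ a] has distribution function G, which dominates that of [Q]. *)
apply: (@le_trans _ _ (\int[Q_ a]_x f (clamp a x))).
  by apply: Rintegral_clamp_le => // x ax; rewrite dfunQ.
(* Undoing the clamp raises both terms: the integrand increases to [f], and the atom's value f(a)
   increases to [L]. *)
rewrite (intQ a (Cfa a)) /= /J; apply: lerD; last by rewrite ler_wpM2l.
apply: le_Rintegral => //; last by move=> x _; rewrite /= clamp_id.
- exact: Cb_integrable muT_lty (Cb_clamp a (Cfa a)).
- exact: Cb_integrable muT_lty Cf.1.
Qed.

Lemma stieltjes_approx e : 0 < e ->
  exists2 Q : borel_prob R, forall x, dfun Q x <= G x & J - e <= \int[Q]_x f x.
Proof.
move=> /f_near[a La]; exists (Q_ a); first exact: dfunQ_le.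
rewrite (intQ a Cf.1) /J lerBlDr.
apply: (le_trans (lerD (le_Rintegral_clamp a muT_lty) (lexx _))).
rewrite (lebesgue_stieltjes_setT Gnd Grc GNy Gy) /=.
rewrite -!addrA lerD2l.
(* Clamping costs [L - f a] on the mass 1 - g of [mu], and the atom of mass g falls short of [L] by
   the same amount; the total is [L - f a]. *)
suff : (L - f a) * (1 - g) + g * (L - f a) <= e.
  by rewrite mulrBr; lra.
by rewrite mulrC -mulrDl subrK mul1r.
Qed.

Lemma stieltjes_integralE :
  (stieltjes_integral Gnd Grc f + (g * L)%:E)%E = J%:E.
Proof. by rewrite /stieltjes_integral [X in (X + _)%E]int_fin. Qed.

End stieltjes_bound.

(** * The formula for gamma and the assembled theorem *)

Lemma gamma_stieltjes {R : realType} (F : R -> R -> R) (hF : feasible F)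
    (hinc : forall m, nondecreasing_fun (F m))
    (hlim : forall m, F m x @[x --> +oo] --> (1 : R)) (m : R) (f : R -> R) : Cb_dec f ->
  gamma (assoc_map F) m f =
    (stieltjes_integral (hinc (- m)%R)
       (feasible_right_continuous hF (m := (- m)%R)) f
     + (lim (F (- m)%R x @[x --> -oo%R]) * lim (f x @[x --> -oo%R]))%:E)%E.
Proof.
move=> Cf.
have F0 x : 0 <= F (- m) x by have /andP[] := feasible_range hF (- m) x.
rewrite (stieltjes_integralE _ _ F0 (hlim _) Cf); apply/le_anti/andP; split.
  apply: ge_ereal_sup => _ [Q /= /(assoc_map_leP hF) Qm <-]; rewrite lee_fin.
  exact: Rintegral_le_stieltjes.
apply/lee_subgt0Pr => e e0; rewrite -EFinB.
have [Q QF eQ] := stieltjes_approx (hinc (- m))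
  (feasible_right_continuous hF (m := - m)) F0 (hlim _) Cf e0.
apply: (@le_trans _ _ (\int[Q]_x f x)%:E); first by rewrite lee_fin.
by apply: ereal_sup_ubound; exists Q => //=; apply/assoc_map_leP.
Qed.

Theorem proposition30 (R : realType) (F : R -> R -> R)
    (hF : feasible F)
    (hinc : forall m, nondecreasing_fun (F m))
    (hlim : forall m, F m x @[x --> +oo] --> (1 : R)) :
  let Phi := assoc_map F in
  [/\ forall P : borel_prob R, (-oo < Phi P)%E,
      forall P Q : borel_prob R, sd_le P Q -> (Phi Q <= Phi P)%E,
      forall (l : {i01 R}) (P Q : borel_prob R),
        (Phi (pconv l P Q) <= maxe (Phi P) (Phi Q))%E &
      lower_semicontinuous (Phi : weak_prob R -> \bar R)]
  /\
  [/\ forall P : borel_prob R,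
        Phi P = ereal_sup [set Rfun Phi (\int[P]_x f x) f | f in Cb_dec],
      forall P : borel_prob R,
        Phi P = ereal_sup [set Rminus Phi (\int[P]_x f x) f | f in Cb_dec],
      forall (t : R) (f : R -> R), Cb f ->
        Rminus Phi t f =
          ereal_inf [set m%:E | m in [set m : R | (t%:E <= gamma Phi m f)%E]] &
      forall (m : R) (f : R -> R), Cb_dec f ->
        gamma Phi m f =
          (stieltjes_integral (hinc (- m)%R)
             (feasible_right_continuous hF (m := (- m)%R)) f
           + (lim (F (- m)%R x @[x --> -oo%R]) * lim (f x @[x --> -oo%R]))%:E)%E].
Proof.
split; split.
- exact: assoc_map_gtNy.
- exact: assoc_map_anti.
- exact: assoc_map_quasiconvex.
- exact: assoc_map_lsc.
- exact: assoc_map_Rfun.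
- exact: assoc_map_Rminus.
- by move=> t f _; exact: Rminus_gamma.
- exact: gamma_stieltjes.
Qed.
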